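(* Let $n_1\geq n_2\geq n_3\geq n_4\geq n_5\geq 1$ be integers with $n_1\geq n_2+3$. Let $H$ and $T$ be graphs with $|H|\geq 1$ and $|T|+\sum_{1\leq s\leq 5}n_s\geq 6500$. Put $$G_1=H\vee(P_{n_1}\cup P_{n_2}\cup P_{n_3}\cup P_{n_4}\cup P_{n_5}\cup T),$$ $$G_2=H\vee(P_{n_1-2}\cup P_{n_2+1}\cup P_{n_3+1}\cup P_{n_4+1}\cup P_{n_5-1}\cup T).$$ Then $\rho(G_1)<\rho(G_2)$.
   Context: All graphs are finite, undirected and simple. $|G|$ denotes the number of vertices of $G$ ($T$ is allowed to be the graph with no vertices). $P_n$ is the path on $n$ vertices, and $P_0$ denotes the empty graph (no vertices). $G\cup G'$ denotes the disjoint union of graphs, and $G\vee G'$ denotes the join, obtained from the disjoint union $G\cup G'$ by adding all edges between vertices of $G$ and vertices of $G'$. The spectral radius $\rho(G)$ is the largest eigenvalue of the adjacency matrix of $G$. *)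

(* Defs.v *)
From mathcomp Require Import all_boot all_order all_algebra.
From mathcomp Require Import polyrcf complex.
From mathcomp Require Import boolp classical_sets reals.

Set Implicit Arguments.
Unset Strict Implicit.
Unset Printing Implicit Defensive.

Import Order.TTheory GRing.Theory Num.Theory.

(* The vertex type may be empty. *)
Record graph := Graph {
  vertex :> finType;
  adj : rel vertex;
  adj_sym : symmetric adj;
  adj_irr : irreflexive adj }.

Declare Scope graph_scope.
Delimit Scope graph_scope with graph.
Bind Scope graph_scope with graph.

Section Operations.
Variables G1 G2 : graph.

Definition union_adj : rel (G1 + G2)%type := fun u v =>
  match u, v with
  | inl x, inl y => adj x y
  | inr x, inr y => adj x y
  | _, _ => false
  end.

Fact union_adj_sym : symmetric union_adj.
Proof. by move=> [x|x] [y|y] //=; rewrite adj_sym. Qed.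

Fact union_adj_irr : irreflexive union_adj.
Proof. by move=> [x|x] /=; rewrite adj_irr. Qed.

Definition graph_union : graph := Graph union_adj_sym union_adj_irr.

Definition join_adj : rel (G1 + G2)%type := fun u v =>
  match u, v with
  | inl x, inl y => adj x y
  | inr x, inr y => adj x y
  | _, _ => true
  end.

Fact join_adj_sym : symmetric join_adj.
Proof. by move=> [x|x] [y|y] //=; rewrite adj_sym. Qed.

Fact join_adj_irr : irreflexive join_adj.
Proof. by move=> [x|x] /=; rewrite adj_irr. Qed.

Definition graph_join : graph := Graph join_adj_sym join_adj_irr.

End Operations.

Notation "G1 ∪ G2" := (graph_union G1 G2)
  (at level 50, left associativity) : graph_scope.
Notation "G1 ∨ G2" := (graph_join G1 G2)
  (at level 50, left associativity) : graph_scope.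

Section Path.
Variable n : nat.

Definition path_adj : rel 'I_n := fun i j => (i.+1 == j) || (j.+1 == i).

Fact path_adj_sym : symmetric path_adj.
Proof. by move=> i j; rewrite /path_adj orbC. Qed.

Fact path_adj_irr : irreflexive path_adj.
Proof. by move=> i; rewrite /path_adj orbb gtn_eqF. Qed.

Definition path_graph : graph := Graph path_adj_sym path_adj_irr.

End Path.

Notation "''P_' n" := (path_graph n)
  (at level 8, n at level 2, format "''P_' n") : graph_scope.

Local Open Scope classical_set_scope.
Local Open Scope ring_scope.

Definition adjacency_matrix (R : realType) (G : graph) : 'M[R]_#|G| :=
  \matrix_(i, j) (adj (enum_val i) (enum_val j))%:R.

(* On a graph with at least one vertex this supremum is attained, hence it is
   the largest eigenvalue: see spectral_radiusP. *)
Definition spectral_radius (R : realType) (G : graph) : R :=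
  sup [set a : R | eigenvalue (adjacency_matrix R G) a].

Section SpectralRadius.
Variables (R : realType) (G : graph).
Let A := adjacency_matrix R G.

Lemma tr_adjacency_matrix : A^T = A.
Proof. by apply/matrixP => i j; rewrite !mxE adj_sym. Qed.

Lemma eigenvalue_adjacency_exists :
  (0 < #|G|)%N -> exists a : R, eigenvalue A a.
Proof.
move=> G_gt0; pose f : {rmorphism R -> R[i]} := real_complex R.
pose B := map_mx f A; pose c : {rmorphism R[i] -> R[i]} := Num.conj.
have /closed_rootP [z] : size (char_poly B) != 1%N.
  by rewrite size_char_poly eqSS -lt0n.
rewrite -eigenvalue_root_char => /eigenvalueP [v vB v_neq0].
have conjB : map_mx c B = B.
  by apply/matrixP => i j; rewrite !mxE !rmorph_nat.
have trB : B^T = B by rewrite /B map_trmx tr_adjacency_matrix.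
pose w := (map_mx c v)^T.
have Bw : B *m w = c z *: w.
  apply: trmx_inj; rewrite trmx_mul trB linearZ /= trmxK.
  by rewrite -{1}conjB -map_mxM vB map_mxZ.
have vw_neq0 : (v *m w) 0 0 != 0.
  rewrite mxE; apply: contraNneq v_neq0 => /eqP.
  rewrite psumr_eq0 => [/allP v0|j _]; last by rewrite !mxE mul_conjC_ge0.
  apply/eqP/rowP => j; have := v0 j (mem_index_enum j).
  by rewrite !mxE mul_conjC_eq0 => /eqP.
have z_real : c z = z.
  apply: (mulIf vw_neq0).
  have := congr1 (fun M : 'M_1 => M 0 0) (mulmxA v B w).
  by rewrite vB Bw -scalemxAr -scalemxAl ![(_ *: _ : 'M_1) _ _]mxE.
have /complex_realP [a za] : z \is Num.real by rewrite CrealE; apply/eqP.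
exists a; rewrite eigenvalue_root_char -(fmorph_root f) map_char_poly.
by rewrite -eigenvalue_root_char; apply/eigenvalueP; exists v; rewrite // vB za.
Qed.

Lemma spectral_radiusP : (0 < #|G|)%N ->
  eigenvalue A (spectral_radius R G) /\
  (forall a, eigenvalue A a -> a <= spectral_radius R G).
Proof.
move=> /eigenvalue_adjacency_exists [a0 Aa0].
pose s := rootsR (char_poly A).
have sE a : (a \in s) = eigenvalue A a.
  rewrite -roots_on_rootsR ?monic_neq0 ?char_poly_monic //.
  by rewrite itv_boundlr /= eigenvalue_root_char.
have [m sm m_max] : exists2 m, m \in s & forall a, a \in s -> a <= m.
  have : a0 \in s by rewrite sE.
  elim: s a0 {sE Aa0} => // x [|y s] IH a0 _.
    by exists x; rewrite ?inE // => a; rewrite inE => /eqP->.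
  have [m ms m_max] := IH y (mem_head _ _).
  exists (Num.max x m).
    by case: leP => _; rewrite !(inE, ms, eqxx, orbT) // -in_cons ms orbT.
  by move=> a /predU1P[->|/m_max am]; rewrite le_max ?lexx ?am ?orbT.
have ubE : ubound [set a : R | eigenvalue A a] m.
  by move=> a /=; rewrite -sE => /m_max.
have -> : spectral_radius R G = m.
  apply/le_anti/andP; split; first by apply: ge_sup => //; exists a0.
  by apply: ub_le_sup; [exists m | rewrite /= -sE].
by split=> [|a]; rewrite -sE // => /m_max.
Qed.

End SpectralRadius.

(* Main.v *)
Require Import Defs.
From mathcomp Require Import all_boot all_order all_algebra.
From mathcomp Require Import reals complex ring lra zify.

Set Implicit Arguments.
Unset Strict Implicit.
Unset Printing Implicit Defensive.

Import Order.TTheory GRing.Theory Num.Theory.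
Local Open Scope ring_scope.

(** The two graphs H ∨ X and H ∨ X' differ only in the part joined to H, and H
    sees that part through a single number. Let a be the spectral radius of
    H ∨ X and let s be the sum of its Perron vector over H, so that s > 0. On X
    the vector is s times a solution z of (a - A_X) z = 1, and on H only the
    total of z over X enters the eigenvalue equation. That total,
    1^T (a - A_X)^-1 1, depends on a and X alone and adds up over disjoint
    unions ([resolvent_sum_unique], [resolvent_sum_unionP]). If X' has a larger
    total at the same a, then replacing the X-part of the vector by the solution
    on X' gives a test vector whose Rayleigh quotient on H ∨ X' exceeds a, so
    the spectral radius grows ([resolvent_sum_radius_lt]). In this way a
    comparison of spectral radii becomes a comparison of totals at one value
    of a, and the part T contributes equally to both sides.

    For a path the system is a linear recurrence. With a = q + 1/q, 0 < q < 1,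
    the total over P_n is c (n + d + e h(n)), where c, e > 0 and d depend on q
    only and h(n) = q^(n+1) / (1 + q^(n+1)) ([resolvent_sum_path]). The
    transfer keeps the number of vertices, so only the sum of the h(n_i)
    matters. Since h decays roughly like q^n, the shortest path decides:
    h(n_5 - 1) > 4 h(n_5) once q <= 1/5, and this gain outweighs whatever is
    lost on the three paths that grow, as each of them loses less than
    h(n_i) <= h(n_5) ([end_term_transfer]). Finally the join contains a star
    with many leaves, so a >= 6 and hence q <= 1/5
    ([spectral_radius_join_ge6], [add_inv_param]). *)

(** * Rayleigh quotients of symmetric matrices *)

(** In an orthonormal eigenbasis the quadratic form is a sum of eigenvalues
    weighted by squared coordinates. The basis is taken over the complex
    extension, where Hermitian matrices are unitarily diagonalizable; the
    diagonal entries are real, hence eigenvalues of A itself. *)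
Lemma rayleigh_le (R : rcfType) n (A : 'M[R]_n) (r : R) :
    A^T = A -> (forall a, eigenvalue A a -> a <= r) ->
  forall v : 'rV_n, (v *m A *m v^T) 0 0 <= r * (v *m v^T) 0 0.
Proof.
move=> symA ler v; pose f : {rmorphism R -> R[i]} := real_complex R.
have conj_f m p (M : 'M[R]_(m, p)) : map_mx Num.conj (map_mx f M) = map_mx f M.
  by apply/matrixP => i j; rewrite !mxE; apply/CrealP/complex_realP; eexists.
pose B := map_mx f A.
have hermB : B \is hermsymmx.
  apply: realsym_hermsym; last first.
    by apply/mxOverP => i j; rewrite !mxE; apply/complex_realP; eexists.
  apply/is_hermitianmxP.
  by rewrite expr0 scale1r map_mx_id // map_trmx symA.
have BE := orthomx_spectralP (hermitian_normalmx hermB).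
set P := spectralmx B in BE; set d := spectral_diag B in BE.
have Pu : P \is unitarymx by apply: spectral_unitarymx.
have PV := invmx_unitary Pu.
have d_le i : d 0 i <= f r.
  have /complex_realP[a da] : d 0 i \is Num.real.
    by have /mxOverP := hermitian_spectral_diag_real hermB; apply.
  rewrite da lecR; apply: ler.
  rewrite eigenvalue_root_char -(fmorph_root f) map_char_poly.
  rewrite -eigenvalue_root_char; apply/eigenvalueP; exists (row i P).
    have PB : P *m B = diag_mx d *m P.
      by rewrite {1}BE !mulmxA mulmxV ?unitarymx_unit // mul1mx.
    by rewrite -row_mul -/B PB row_mul row_diag_mx -scalemxAl -rowE da.
  apply/eqP => P0; have := row_mul i P (invmx P).
  rewrite P0 mul0mx mulmxV ?unitarymx_unit // => /rowP/(_ i).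
  by rewrite !mxE eqxx => /eqP; rewrite oner_eq0.
pose w := map_mx f v *m P^t*%sesqui.
have wE : w^t*%sesqui = P *m (map_mx f v)^T.
  by rewrite trmx_mul map_mxM /= trmxCK map_trmx conj_f.
have normE : f ((v *m v^T) 0 0) = \sum_j w 0 j * (w 0 j)^*.
  have -> : f ((v *m v^T) 0 0) = (map_mx f (v *m v^T)) 0 0 by rewrite [RHS]mxE.
  have -> : map_mx f (v *m v^T) = w *m w^t*%sesqui.
    rewrite wE !mulmxA -(mulmxA _ _ P) -PV mulVmx ?unitarymx_unit // mulmx1.
    by rewrite map_mxM map_trmx.
  by rewrite mxE; apply: eq_bigr => j _; rewrite !mxE.
have formE : f ((v *m A *m v^T) 0 0) = \sum_j d 0 j * (w 0 j * (w 0 j)^*).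
  have -> : f ((v *m A *m v^T) 0 0) = (map_mx f (v *m A *m v^T)) 0 0.
    by rewrite [RHS]mxE.
  have -> : map_mx f (v *m A *m v^T) = w *m diag_mx d *m w^t*%sesqui.
    by rewrite wE /w -PV !map_mxM /= -/B BE !mulmxA map_trmx.
  rewrite mul_mx_diag mxE; apply: eq_bigr => j _.
  by rewrite !mxE mulrA; congr (_ * _); rewrite mulrC.
rewrite -lecR -/(f _) -/(f (_ * _)) rmorphM formE normE mulr_sumr.
by apply: ler_sum => j _; rewrite ler_wpM2r // mul_conjC_ge0.
Qed.

(** * The adjacency operator on functions of the vertices *)

Section AdjacencyOperator.
Variables (R : realType) (G : graph).
Implicit Types x y : G -> R.

Definition nbr_sum x (u : G) : R := \sum_(w | adj u w) x w.

Definition adj_form x : R := \sum_u x u * nbr_sum x u.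

Lemma nbr_sumD x y u : nbr_sum (fun w => x w + y w) u = nbr_sum x u + nbr_sum y u.
Proof. exact: big_split. Qed.

Lemma nbr_sumZ c x u : nbr_sum (fun w => c * x w) u = c * nbr_sum x u.
Proof. by rewrite /nbr_sum mulr_sumr. Qed.

Lemma nbr_sum_sym x y : \sum_u y u * nbr_sum x u = \sum_u nbr_sum y u * x u.
Proof.
rewrite /nbr_sum; under eq_bigr do rewrite mulr_sumr.
under [RHS]eq_bigr do rewrite mulr_suml.
rewrite (exchange_big_dep predT) //=; apply: eq_bigr => u _.
by apply: eq_bigl => w; rewrite adj_sym.
Qed.

Let A := adjacency_matrix R G.

Lemma adj_form_matrix x (v := \row_i x (enum_val i) : 'rV[R]_#|G|) :
  adj_form x = (v *m A *m v^T) 0 0.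
Proof.
rewrite /adj_form (reindex_onto enum_val enum_rank) => [|u _]; last first.
  by rewrite enum_rankK.
rewrite mxE; apply: eq_big => [i|i _]; first by rewrite enum_valK eqxx.
rewrite mulrC ![in RHS]mxE; congr (_ * _).
rewrite /nbr_sum (reindex_onto enum_val enum_rank) => [|u _]; last first.
  by rewrite enum_rankK.
rewrite big_mkcond; apply: eq_bigr => j _.
by rewrite !mxE enum_valK eqxx andbT adj_sym; case: adj; rewrite ?mulr1 ?mulr0.
Qed.

Lemma sqnorm_matrix x (v := \row_i x (enum_val i) : 'rV[R]_#|G|) :
  \sum_u x u ^+ 2 = (v *m v^T) 0 0.
Proof.
rewrite (reindex_onto enum_val enum_rank) => [|u _]; last by rewrite enum_rankK.
rewrite mxE; apply: eq_big => [i|i _]; first by rewrite enum_valK eqxx.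
by rewrite !mxE expr2.
Qed.

Hypothesis G_gt0 : (0 < #|G|)%N.
Let rho := spectral_radius R G.

Lemma adj_form_le x : adj_form x <= rho * \sum_u x u ^+ 2.
Proof.
rewrite adj_form_matrix sqnorm_matrix; apply: rayleigh_le.
  exact: tr_adjacency_matrix.
by have [_] := spectral_radiusP R G_gt0.
Qed.

(** The form rho |x|^2 - adj_form x is nonnegative and vanishes at x, so its
    gradient there, which is proportional to rho x - A x, is zero. *)
Lemma adj_form_max x :
  adj_form x = rho * \sum_u x u ^+ 2 -> forall u, rho * x u = nbr_sum x u.
Proof.
(* Moving from x in the direction e of the gradient by a step t changes the
   form minus rho times the squared norm by 2 t |e|^2 - t^2 b; the step
   a / (b + 1) makes this positive unless e = 0. *)
move=> xmax; pose e u := nbr_sum x u - rho * x u.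
pose a := \sum_u e u ^+ 2.
pose b := rho * \sum_u e u ^+ 2 - adj_form e.
have b_ge0 : 0 <= b by rewrite subr_ge0 adj_form_le.
have expand t : adj_form (fun u => x u + t * e u)
    - rho * (\sum_u (x u + t * e u) ^+ 2) = 2 * t * a - t ^+ 2 * b.
  have -> : 2 * t * a - t ^+ 2 * b = (adj_form x - rho * \sum_u x u ^+ 2)
      + t * (a + a) - t ^+ 2 * b by rewrite xmax; ring.
  have aE : a + a = \sum_u e u * nbr_sum x u + \sum_u x u * nbr_sum e u
      - 2 * rho * \sum_u x u * e u.
    rewrite [X in _ + X - _]nbr_sum_sym mulr_sumr -sumrN -!big_split /=.
    by apply: eq_bigr => u _; rewrite /e; ring.
  rewrite aE /b /adj_form !mulrBr !mulrDr !mulr_sumr.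
  rewrite -!sumrN -!big_split -sumrN -big_split /=.
  apply: eq_bigr => u _; rewrite nbr_sumD nbr_sumZ; ring.
have a0 : a = 0.
  have := adj_form_le (fun u => x u + a / (b + 1) * e u).
  rewrite -subr_le0 expand.
  have b1 : b + 1 != 0 by rewrite gt_eqF // ltr_wpDl.
  have -> : 2 * (a / (b + 1)) * a - (a / (b + 1)) ^+ 2 * b =
            (a / (b + 1)) ^+ 2 * (b + 2) by field.
  rewrite pmulr_lle0 ?ltr_wpDl // => h.
  have /eqP : (a / (b + 1)) ^+ 2 = 0 by apply/le_anti; rewrite h sqr_ge0.
  by rewrite sqrf_eq0 mulf_eq0 invr_eq0 (negPf b1) orbF => /eqP.
move=> u; apply/eqP; rewrite eq_sym -subr_eq0 -/(e u) -sqrf_eq0.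
by move/psumr_eq0P : a0 => -> // w _; exact: sqr_ge0.
Qed.

(** Taking absolute values in a top eigenvector keeps the norm and can only
    increase the form, so the result is still maximal. *)
Lemma perron : exists x : G -> R, [/\ forall u, 0 <= x u, exists u, x u != 0
  & forall u, rho * x u = nbr_sum x u].
Proof.
have [/eigenvalueP[v vA v0] _] := spectral_radiusP R G_gt0.
pose x u := v 0 (enum_rank u); exists (fun u => `|x u|); split=> //.
  have /rV0Pn[i vi] := v0.
  by exists (enum_val i); rewrite normr_eq0 /x enum_valK.
apply: adj_form_max; apply/le_anti; rewrite adj_form_le /=.
have -> : \sum_u `|x u| ^+ 2 = \sum_u x u ^+ 2.
  by apply: eq_bigr => u _; rewrite real_normK ?num_real.
have vE : v = \row_i x (enum_val i).
  by apply/rowP => i; rewrite mxE /x enum_valK.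
have -> : rho * (\sum_u x u ^+ 2) = adj_form x.
  by rewrite adj_form_matrix sqnorm_matrix -vE vA -scalemxAl [in RHS]mxE.
apply: ler_sum => u _; apply: le_trans (ler_norm _) _.
by rewrite normrM ler_wpM2l // ler_norm_sum.
Qed.

End AdjacencyOperator.

(** * Joins *)

Section Join.
Variables (R : realType) (H X : graph).

Definition join_fun (y : H -> R) (z : X -> R) : (H ∨ X)%graph -> R :=
  fun u => match u with inl h => y h | inr u => z u end.

Lemma sum_join (F : (H ∨ X)%graph -> R) :
  \sum_u F u = \sum_h F (inl h) + \sum_u F (inr u).
Proof. exact: big_sumType. Qed.

Lemma nbr_sum_join_l x h :
  nbr_sum (R := R) (G := H ∨ X) x (inl h) =
    nbr_sum (fun h => x (inl h)) h + \sum_u x (inr u).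
Proof. exact: big_sumType. Qed.

Lemma nbr_sum_join_r x u :
  nbr_sum (R := R) (G := H ∨ X) x (inr u) =
    \sum_h x (inl h) + nbr_sum (fun u => x (inr u)) u.
Proof. exact: big_sumType. Qed.

Lemma adj_form_join y z :
  adj_form (join_fun y z) =
    adj_form y + 2 * ((\sum_h y h) * \sum_u z u) + adj_form z.
Proof.
rewrite /adj_form sum_join.
under eq_bigr do rewrite nbr_sum_join_l mulrDr.
under [X in _ + X]eq_bigr do rewrite nbr_sum_join_r mulrDr.
rewrite !big_split -!mulr_suml /=; ring.
Qed.

Lemma sqnorm_join y z :
  \sum_u join_fun y z u ^+ 2 = \sum_h y h ^+ 2 + \sum_u z u ^+ 2.
Proof. exact: sum_join. Qed.

Lemma card_join_gt0 : (0 < #|H|)%N -> (0 < #|(H ∨ X)%graph|)%N.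
Proof. by move=> H_gt0; rewrite card_sum ltn_addr. Qed.

End Join.

(** The test vector lives on a star centred in H with X as its leaves. With
    N = |X| leaves, each of weight 1, the centre weight 6 gives the quotient
    12 N / (36 + N), which is at least 6 when N >= 36. *)
Lemma spectral_radius_join_ge6 (R : realType) (H X : graph) :
  (0 < #|H|)%N -> (36 <= #|X|)%N -> 6 <= spectral_radius R (H ∨ X)%graph.
Proof.
move=> H_gt0 X_ge; have [h0 _] := card_gt0P H_gt0.
pose y (h : H) : R := 6 * (h == h0)%:R; pose z (u : X) : R := 1.
have sum_y : \sum_h y h = 6.
  rewrite -mulr_sumr (bigD1 h0) //= eqxx big1 ?addr0 ?mulr1 //.
  by move=> h /negPf->.
have norm_y : \sum_h y h ^+ 2 = 36.
  rewrite (bigD1 h0) //= /y eqxx big1 => [|h /negPf->].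
    by rewrite mulr1 addr0; ring.
  by rewrite mulr0 expr0n.
have sum_z : \sum_u z u = #|X|%:R by rewrite sumr_const.
have norm_z : \sum_u z u ^+ 2 = #|X|%:R.
  by rewrite -sum_z; apply: eq_bigr => u _; rewrite expr1n.
have form_ge0 (G : graph) (x : G -> R) : (forall u, 0 <= x u) -> 0 <= adj_form x.
  by move=> x0; apply: sumr_ge0 => u _; apply/mulr_ge0/sumr_ge0.
have := adj_form_le (card_join_gt0 X H_gt0) (join_fun y z).
rewrite adj_form_join sqnorm_join sum_y norm_y sum_z norm_z.
have y_ge0 : 0 <= adj_form y by apply: form_ge0 => h; rewrite mulr_ge0.
have z_ge0 : 0 <= adj_form z by apply: form_ge0.
have : (36 : R) <= #|X|%:R by rewrite ler_nat.
set r := spectral_radius _ _; set N := #|X|%:R => N36 form_le.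
rewrite leNgt; apply/negP => r6.
have := ltr_pM2r (x := 36 + N) => /(_ _)/(_ r 6); rewrite r6; lra.
Qed.

(** * The total of the solution of (a - A) z = 1 *)

Section ResolventSum.
Variables (R : realType) (a : R).

Definition resolvent_one (G : graph) (z : G -> R) :=
  forall u, a * z u = nbr_sum z u + 1.

(** The value 1^T (a - A)^-1 1, given as a relation so that invertibility of
    a - A need not be discussed. *)
Definition resolvent_sum (G : graph) (t : R) :=
  exists2 z : G -> R, resolvent_one z & \sum_u z u = t.

(** The solution itself may fail to be unique when a is an eigenvalue, but
    pairing one solution with a - A applied to the other gives both totals,
    by symmetry of A. *)
Lemma resolvent_sum_unique G t t' :
  resolvent_sum G t -> resolvent_sum G t' -> t = t'.
Proof.
move=> [z zP <-] [z' z'P <-].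
have pair : \sum_u z' u * (a * z u - nbr_sum z u) =
            \sum_u (a * z' u - nbr_sum z' u) * z u.
  under eq_bigr do rewrite mulrBr; under [RHS]eq_bigr do rewrite mulrBl.
  rewrite !sumrB nbr_sum_sym; congr (_ - _).
  by apply: eq_bigr => u _; rewrite mulrCA mulrA.
rewrite (eq_bigr z') in pair; last by move=> u _; rewrite zP addrC addKr mulr1.
by rewrite pair; apply: eq_bigr => u _; rewrite z'P addrC addKr mul1r.
Qed.

Lemma nbr_sum_union_l (G G' : graph) x u :
  nbr_sum (G := G ∪ G') x (inl u) = nbr_sum (R := R) (fun w => x (inl w)) u.
Proof.
by rewrite /nbr_sum [LHS]big_sumType /= [X in _ + X]big_pred0 ?addr0.
Qed.

Lemma nbr_sum_union_r (G G' : graph) x u :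
  nbr_sum (G := G ∪ G') x (inr u) = nbr_sum (R := R) (fun w => x (inr w)) u.
Proof.
by rewrite /nbr_sum [LHS]big_sumType /= [X in X + _]big_pred0 ?add0r.
Qed.

Lemma resolvent_sum_union G G' t t' :
  resolvent_sum G t -> resolvent_sum G' t' ->
  resolvent_sum (G ∪ G') (t + t').
Proof.
move=> [z zP <-] [z' z'P <-].
exists (fun u => match u with inl w => z w | inr w => z' w end).
  by move=> [u|u]; rewrite (nbr_sum_union_l, nbr_sum_union_r) ?zP ?z'P.
exact: big_sumType.
Qed.

Lemma resolvent_sum_unionP G G' t : resolvent_sum (G ∪ G') t ->
  exists t1 t2, [/\ t = t1 + t2, resolvent_sum G t1 & resolvent_sum G' t2].
Proof.
move=> [z zP <-].
exists (\sum_u z (inl u)), (\sum_u z (inr u)); split; first exact: big_sumType.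
- by exists (fun u => z (inl u)) => // u; rewrite zP nbr_sum_union_l.
- by exists (fun u => z (inr u)) => // u; rewrite zP nbr_sum_union_r.
Qed.

End ResolventSum.

(** The top eigenvector of H ∨ X, scaled to have sum 1 over H, consists of some
    y on H and a solution z on X, with total t. With z' on X' of total t',
    the vector (y, z') has form rho |(y, z')|^2 + (t' - t). *)
Lemma resolvent_sum_radius_lt (R : realType) (H X X' : graph)
    (rho := spectral_radius R (H ∨ X)%graph) : (0 < #|H|)%N ->
  (forall t, resolvent_sum rho X t ->
     exists2 t', t < t' & resolvent_sum rho X' t') ->
  rho < spectral_radius R (H ∨ X')%graph.
Proof.
move=> H_gt0 impr; have [h0 _] := card_gt0P H_gt0.
have [x [x_ge0 x_neq0 xP]] := perron R (card_join_gt0 X H_gt0).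
pose s := \sum_h x (inl h).
(* A nonnegative eigenvector that vanishes on H vanishes on X as well, because
   every vertex of H is adjacent to all of X. *)
have s_neq0 : s != 0.
  apply/eqP => s0; have [u /eqP[]] := x_neq0.
  have xH h : x (inl h) = 0 by move/psumr_eq0P: s0 => ->.
  have := xP (inl h0); rewrite nbr_sum_join_l xH mulr0 => /esym/eqP.
  rewrite paddr_eq0 ?sumr_ge0 // => /andP[_ /eqP /psumr_eq0P xX].
  by case: u => u; [exact: xH | apply: xX].
pose y h := s^-1 * x (inl h); pose z u := s^-1 * x (inr u).
have sum_y : \sum_h y h = 1 by rewrite -mulr_sumr mulVf.
have zP : resolvent_one rho z.
  move=> u; rewrite mulrCA xP nbr_sum_join_r mulrDr mulVf // addrC.
  by rewrite nbr_sumZ.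
have yP h : rho * y h = nbr_sum y h + \sum_u z u.
  by rewrite /y /z mulrCA xP nbr_sum_join_l mulrDr nbr_sumZ -mulr_sumr.
have [t' lt_t [z' z'P sum_z']] := impr _ (ex_intro2 _ _ z zP erefl).
have form_y : adj_form y = rho * \sum_h y h ^+ 2 - \sum_u z u.
  apply: (@addIr _ (\sum_u z u)); rewrite subrK -[in LHS](mul1r (\sum_u z u)).
  rewrite -sum_y mulr_suml -big_split mulr_sumr /=; apply: eq_bigr => h _.
  by rewrite -mulrDr -yP expr2 mulrCA.
have form_z' : adj_form z' = rho * \sum_u z' u ^+ 2 - t'.
  apply: (@addIr _ t'); rewrite subrK -[in LHS]sum_z'.
  rewrite -big_split mulr_sumr /=; apply: eq_bigr => u _.
  by rewrite -[X in _ + X]mulr1 -mulrDr -z'P expr2 mulrCA.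
have := adj_form_le (card_join_gt0 X' H_gt0) (join_fun y z').
rewrite adj_form_join sqnorm_join form_y form_z' sum_y sum_z'.
have : 0 <= \sum_h y h ^+ 2 + \sum_u z' u ^+ 2.
  by rewrite addr_ge0 ?sumr_ge0 // => *; exact: sqr_ge0.
rewrite ltNge => N_ge0 form_le; apply/negP => rho_le.
have := ler_wpM2r N_ge0 rho_le; lra.
Qed.

(** * Paths *)

Section PathResolvent.
Variables (R : realType) (q : R).

(** Vertex i of the path is placed at position i + 1, so that the two missing
    neighbours of the ends sit at positions 0 and n + 1, where g vanishes. *)
Lemma nbr_sum_path n (g : nat -> R) (i : ('P_n)%graph) :
  g 0%N = 0 -> g n.+1 = 0 ->
  nbr_sum (fun j : ('P_n)%graph => g j.+1) i = g i + g i.+2.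
Proof.
move=> g0 gn; rewrite /nbr_sum /= /path_adj.
have E : \sum_(j < n | (i.+1 == j) || (j.+1 == i)) g j.+1 =
         \sum_(j < n) ((if j.+1 == i then g j.+1 else 0)
                     + (if i.+1 == j then g j.+1 else 0)).
  rewrite big_mkcond; apply: eq_bigr => j _.
  case: (eqVneq i.+1 j) => [<-|_] /=; last by rewrite addr0.
  by rewrite gtn_eqF ?add0r // -addn2 -{1}(addn0 i) ltn_add2l.
rewrite [LHS]E big_split /= -!big_mkcond; congr (_ + _).
  case: i {E} => [[|k] kn] /=; first by rewrite big_pred0 // g0.
  under eq_bigl do rewrite eqSS.
  by rewrite (big_ord1_eq _ (fun j => g j.+1)) ltnW.
under eq_bigl do rewrite eq_sym.
rewrite (big_ord1_eq _ (fun j => g j.+1)).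
case: ltnP => // le_n; have -> : i.+2 = n.+1; last by rewrite gn.
by apply/eqP; rewrite eqSS eqn_leq le_n ltn_ord.
Qed.

(** The interaction of the two ends of a path, the only contribution to the
    total that is not affine in n. *)
Definition end_term n : R := q ^+ n.+1 / (1 + q ^+ n.+1).

Hypotheses (q_gt0 : 0 < q) (q_lt1 : q < 1).

Definition path_total n : R :=
  q / (1 - q) ^+ 2 *
    (n%:R - 2 * q / (1 - q) + 2 * (1 + q) / (1 - q) * end_term n).

(** The constant solution 1 / (a - 2) = q / (1 - q)^2 of the recurrence is
    corrected at both ends by the homogeneous solutions q^k and q^(n+1-k), in
    the symmetric combination that vanishes at positions 0 and n + 1. *)
Lemma resolvent_sum_path n : resolvent_sum (q + q^-1) ('P_n)%graph (path_total n).
Proof.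
pose c := q / (1 - q) ^+ 2; pose D := 1 + q ^+ n.+1.
have q0 : q != 0 by rewrite gt_eqF.
have q1 : 1 - q != 0 by rewrite subr_eq0 gt_eqF.
have D0 : D != 0 by rewrite gt_eqF // addr_gt0 ?exprn_gt0.
pose g k := c * (1 - (q ^+ k + q ^+ (n.+1 - k)) / D).
exists (fun i : ('P_n)%graph => g i.+1).
  move=> i; rewrite nbr_sum_path.
  - have in_ := ltn_ord i; rewrite /g subSS.
    have -> : (n.+1 - i = (n - i.+1).+2)%N by lia.
    have -> : (n.+1 - i.+2 = n - i.+1)%N by lia.
    have -> : (n - i = (n - i.+1).+1)%N by lia.
    rewrite !exprS /c; field; rewrite ?q0 ?q1 ?D0 //.
  - by rewrite /g subn0 expr0 -/D divff // subrr mulr0.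
  - by rewrite /g subnn expr0 (addrC _ 1) -/D divff // subrr mulr0.
have geom : \sum_(i < n) q ^+ i.+1 = (q - q ^+ n.+1) / (1 - q).
  apply: (mulIf q1); rewrite divfK //.
  elim: n {D D0 g} => [|m IH]; first by rewrite big_ord0 mul0r expr1 subrr.
  rewrite big_ord_recr mulrDl IH /= !exprS; ring.
have geom_rev : \sum_(i < n) q ^+ (n.+1 - i.+1) = (q - q ^+ n.+1) / (1 - q).
  rewrite -geom (reindex_inj rev_ord_inj) /=; apply: eq_bigr => i _.
  by congr (_ ^+ _); have := ltn_ord i; lia.
rewrite -mulr_sumr sumrB -mulr_suml big_split geom geom_rev sumr_const card_ord.
rewrite /path_total /end_term -/D -/c; congr (_ * _).
rewrite /D in D0 *; set p := q ^+ n.+1 in D0 *.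
rewrite /=; field; rewrite ?q1 ?D0 //.
Qed.

End PathResolvent.

(** * Moving vertices between paths *)

Section EndTerm.
Variables (R : realType) (q : R).
Hypotheses (q_gt0 : 0 < q) (q_le : q <= 5^-1).

Let q_le1 : q <= 1. Proof. by apply: le_trans q_le _; lra. Qed.

Lemma end_term_gt0 n : 0 < end_term q n.
Proof. by rewrite divr_gt0 ?addr_gt0 ?exprn_gt0. Qed.

Lemma end_term_le m n : (m <= n)%N -> end_term q n <= end_term q m.
Proof.
move=> le_mn; have : q ^+ n.+1 <= q ^+ m.+1.
  by apply: ler_wiXn2l; rewrite ?ltnS // ltW.
have := exprn_gt0 n.+1 q_gt0; have := exprn_gt0 m.+1 q_gt0.
rewrite /end_term; set a := q ^+ n.+1; set b := q ^+ m.+1 => b0 a0 le_ab.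
rewrite ler_pdivrMr ?addr_gt0 // mulrAC ler_pdivlMr ?addr_gt0 //; nra.
Qed.

(** The ratio of consecutive values is close to q; the factor 4 leaves room for
    the shortest path itself and one copy for each of the three that grow. *)
Lemma end_term_step n : 4 * end_term q n.+1 < end_term q n.
Proof.
have : q ^+ n.+1 <= 5^-1.
  rewrite exprS; apply: le_trans q_le.
  by rewrite ler_piMr ?exprn_ile1 ?(ltW q_gt0).
have := exprn_gt0 n.+1 q_gt0.
rewrite /end_term (exprS q n.+1); set p := q ^+ n.+1 => p0 p_le.
rewrite mulrA ltr_pdivrMr ?addr_gt0 ?mulr_gt0 // mulrAC ltr_pdivlMr ?addr_gt0 //.
have qp : 0 < q * p by rewrite mulr_gt0.
have : 4 * q * (1 + p) < 1 + q * p.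
  have : q * p <= 25^-1.
    have -> : 25^-1 = 5^-1 * 5^-1 :> R by field.
    by apply: ler_pM => //; exact: ltW.
  have : q <= 5^-1 by [].
  lra.
rewrite -(ltr_pM2l p0); lra.
Qed.

(** Each of the three growing paths loses less than its own value, which is at
    most the value at n5; the path n1 does not lose when shortened. *)
Lemma end_term_transfer n1 n2 n3 n4 n5 :
  (0 < n5)%N -> (n5 <= n2)%N -> (n5 <= n3)%N -> (n5 <= n4)%N ->
  end_term q n1 + end_term q n2 + end_term q n3 + end_term q n4 + end_term q n5
  < end_term q (n1 - 2) + end_term q (n2 + 1) + end_term q (n3 + 1)
    + end_term q (n4 + 1) + end_term q (n5 - 1).
Proof.
case: n5 => // k _ le2 le3 le4; rewrite subn1 /=.
have := end_term_step k; have := end_term_le (leq_subr 2 n1).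
have := end_term_le le2; have := end_term_le le3; have := end_term_le le4.
have := end_term_gt0 (n2 + 1); have := end_term_gt0 (n3 + 1).
have := end_term_gt0 (n4 + 1); lra.
Qed.

End EndTerm.

(** Both sides have the same number of paths and of vertices, so the terms of
    [path_total] other than [end_term] cancel. *)
Lemma path_total_transfer (R : realType) (q : R) n1 n2 n3 n4 n5 :
  0 < q -> q <= 5^-1 -> (1 < n1)%N ->
  (0 < n5)%N -> (n5 <= n2)%N -> (n5 <= n3)%N -> (n5 <= n4)%N ->
  path_total q n1 + path_total q n2 + path_total q n3 + path_total q n4
    + path_total q n5
  < path_total q (n1 - 2) + path_total q (n2 + 1) + path_total q (n3 + 1)
    + path_total q (n4 + 1) + path_total q (n5 - 1).
Proof.
move=> q_gt0 q_le n1_gt1 n5_gt0 le2 le3 le4.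
have q1 : 0 < 1 - q by lra.
have c_gt0 : 0 < q / (1 - q) ^+ 2 by rewrite divr_gt0 ?exprn_gt0.
have e_gt0 : 0 < 2 * (1 + q) / (1 - q) by apply: divr_gt0 => //; lra.
have := end_term_transfer q_gt0 q_le n1 n5_gt0 le2 le3 le4.
rewrite -subr_gt0 => gain; rewrite -subr_gt0.
have := mulr_gt0 c_gt0 (mulr_gt0 e_gt0 gain).
by congr (0 < _); rewrite /path_total !natrD !natrB //; ring.
Qed.

Lemma add_inv_param (R : rcfType) (a : R) : 6 <= a ->
  exists q, [/\ 0 < q, q <= 5^-1 & a = q + q^-1].
Proof.
move=> a6; have a0 : 0 < a by lra.
have D0 : 0 <= a ^+ 2 - 4 by nra.
pose s := Num.sqrt (a ^+ 2 - 4).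
have ss : s ^+ 2 = a ^+ 2 - 4 by rewrite sqr_sqrtr.
have s0 : 0 <= s by rewrite sqrtr_ge0.
have s_lt : s < a by nra.
(* This is q <= 1/5; it holds because (a - 2/5)^2 <= a^2 - 4 as soon as
   a >= 26/5 = 5 + 1/5. *)
have s_ge : a - 2 / 5 <= s by nra.
have q0 : 0 < (a - s) / 2 by lra.
exists ((a - s) / 2); split=> //; first lra.
suff -> : ((a - s) / 2)^-1 = (a + s) / 2 by field.
apply: (mulfI (lt0r_neq0 q0)); rewrite mulfV ?lt0r_neq0 //.
have -> : (a - s) / 2 * ((a + s) / 2) = (a ^+ 2 - s ^+ 2) / 4 by field.
by rewrite ss; field.
Qed.

Theorem lemma1p3 (R : realType) (n1 n2 n3 n4 n5 : nat) (H T : graph)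
    (h12 : (n2 <= n1)%N) (h23 : (n3 <= n2)%N) (h34 : (n4 <= n3)%N)
    (h45 : (n5 <= n4)%N) (h5 : (1 <= n5)%N) (hgap : (n2 + 3 <= n1)%N)
    (hH : (1 <= #|H|)%N)
    (hsize : (6500 <= #|T| + (n1 + n2 + n3 + n4 + n5))%N) :
  spectral_radius R
    (H ∨ ('P_n1 ∪ 'P_n2 ∪ 'P_n3 ∪ 'P_n4 ∪ 'P_n5 ∪ T))%graph
  < spectral_radius R
    (H ∨ ('P_(n1 - 2) ∪ 'P_(n2 + 1) ∪ 'P_(n3 + 1) ∪ 'P_(n4 + 1)
            ∪ 'P_(n5 - 1) ∪ T))%graph.
Proof.
apply: resolvent_sum_radius_lt => //; set rho := spectral_radius _ _.
have rho6 : 6 <= rho.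
  apply: spectral_radius_join_ge6 => //.
  rewrite !card_sum !card_ord addnC; apply: leq_trans hsize; exact: leq_trans.
have [q [q_gt0 q_le ->]] := add_inv_param rho6.
have q_lt1 : q < 1 by lra.
have path_sum n := resolvent_sum_path q_gt0 q_lt1 n.
have path_uniq n := resolvent_sum_unique (path_sum n).
move=> t /resolvent_sum_unionP[? [tT [-> + T_sum]]].
do 4![case/resolvent_sum_unionP => ? [? [-> + /path_uniq <-]]].
move=> /path_uniq <-.
exists (path_total q (n1 - 2) + path_total q (n2 + 1) + path_total q (n3 + 1)
  + path_total q (n4 + 1) + path_total q (n5 - 1) + tT).
  by rewrite ltrD2r; apply: path_total_transfer => //; lia.
by do !apply: resolvent_sum_union => //.
Qed.
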